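(* Let $M$ be a separable metric space with metric $d$ and Borel measure $\mu$ such that all balls have finite measure. Let $\mathcal{A}$ be a doubling family of (measurable) subsets of $M$ of positive measure. (i) The maximal function $$M_{\mathcal{A}}f(x)=\sup_{Q\in\mathcal{A},\,x\in Q}\frac{1}{\mu(Q)}\int_Q|f|\,d\mu$$ is of weak type $(1,1)$. (ii) If $\mathcal{A}$ is dense, then for each $f\in L^1(\mu)$ $$\lim_{r\to 0+}\ \sup_{Q\in\mathcal{A},\ \mathrm{diam}(Q)\le r,\ x\in Q}\frac{1}{\mu(Q)}\int_Q|f|\,d\mu=|f|(x)$$ for all $x\in M$ except possibly a set of $\mu$-measure $0$. (iii) If $\mathcal{A}$ is dense and consists of doubling sets (with a common doubling constant $C$), then $M$ has the Calderón–Zygmund property.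
   Context: All operations on sets are meant as operations in the lattice of measurable sets on $M$. A set $Q\subset M$ is a doubling set with constant $C$ iff $\mu(\{x: d(x,Q)\le \frac1C\mathrm{diam}(Q)\})\le C\mu(Q)$. A family $\mathcal{A}$ of sets is a doubling family with constant $C$ if for each $Q\in\mathcal{A}$ the following two conditions hold: (a) the set $\tilde Q=\bigcup_{R\in\mathcal{A},\ R\cap Q\ne\emptyset,\ \mu(R)\le 2\mu(Q)}R$ is contained in a set $S\in\mathcal{A}$ such that $\mu(S)\le C\mu(Q)$; (b) either $\mu(M)\le C\mu(Q)$ and $M\in\mathcal{A}$, or there is $R\in\mathcal{A}$ such that $Q\subset R$ and $2\mu(Q)\le\mu(R)\le C\mu(Q)$. $\mathcal{A}$ is a doubling family if it is one with some constant $C$. A family $\mathcal{A}$ is dense if for almost every $x\in M$ and all $r>0$ there is $Q\in\mathcal{A}$ such that $x\in Q$ and $\mathrm{diam}(Q)\le r$. Weak type $(1,1)$ of $M_{\mathcal{A}}$ means: there is a constant $C'$ such that $\mu(\{x: M_{\mathcal{A}}f(x)>\lambda\})\le \frac{C'}{\lambda}\|f\|_{L^1}$ for all $f\in L^1(\mu)$, $\lambda>0$. Calderón–Zygmund property: a space $M$ with metric $d$ and Borel measure $\mu$ has the Calderón–Zygmund property if there exists a constant $C$ such that for every $f\in L^1(\mu)$ and every $\lambda>C\frac{\|f\|_{L^1}}{\mu(M)}$ (every $\lambda>0$ if $\mu(M)=\infty$) there is a decomposition $f=\sum_i f_i+g$ (a countable sum), such that there exist sets $Q_i\subset M$, numbers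 $r_i>0$ and points $x_i\in M$ satisfying: (1) $f_i=0$ outside $Q_i$; (2) $\int f_i\,d\mu=0$; (3) $Q_i\subset B(x_i,Cr_i)$; (4) $\sum_i\mu(Q_i^* )\le C\frac{\|f\|_{L^1}}{\lambda}$, where $Q_i^*=\{x: d(x,Q_i)<r_i\}$; (5) $\sum_i\|f_i\|_{L^1}\le C\|f\|_{L^1}$; (6) $|g|\le C\lambda$. Here $B(x,r)$ denotes the ball of centre $x$ and radius $r$. *)

(* Defs.v *)
From HB Require Import structures.
From mathcomp Require Import all_boot all_order all_algebra.
From mathcomp Require Import all_classical all_reals all_analysis.

Set Implicit Arguments.
Unset Strict Implicit.
Unset Printing Implicit Defensive.

Import Order.TTheory GRing.Theory Num.Theory.
Import numFieldNormedType.Exports.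

Local Open Scope classical_set_scope.
Local Open Scope ring_scope.
Local Open Scope ereal_scope.

#[short(type="metricMeasurableType")]
HB.structure Definition MetricMeasurable d (K : numDomainType) :=
  {M of Measurable d M & Metric K M}.

Definition separable (T : topologicalType) :=
  exists2 D : set T, countable D & dense D.

Section metric_sets.
Context {R : realType} {M : metricType R}.

(* Extended-real valued: +oo on unbounded sets, and -oo on the empty set. *)
Definition diam (Q : set M) : \bar R :=
  ereal_sup [set (mdist p.1 p.2)%:E | p in Q `*` Q].

(* +oo when Q is empty. *)
Definition dist_set (x : M) (Q : set M) : \bar R :=
  ereal_inf [set (mdist x y)%:E | y in Q].

End metric_sets.

Section doubling.
Context {d : measure_display} {R : realType} {M : metricMeasurableType d R}.
Variable mu : {measure set M -> \bar R}.
Implicit Types (A : set (set M)) (Q : set M) (f g : M -> R) (C : R).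

Definition borel_space := @measurable d M = <<s @open M >>.

(* For C > 0 and diam Q = +oo the enlarged set is the whole space. *)
Definition doubling_set C Q :=
  mu [set x | dist_set x Q <= (C^-1)%:E * diam Q] <= C%:E * mu Q.

(* An uncountable union need not be measurable, but enlarge A Q is only used
   through its inclusion in a measurable set, and S contains it exactly when S
   is an upper bound, in the lattice of measurable sets, of the sets of which
   it is the union. *)
Definition enlarge A Q : set M :=
  \bigcup_(S in [set S | [/\ A S, S `&` Q !=set0 & mu S <= 2%:E * mu Q]]) S.

Definition doubling_family_with C A :=
  (0 < C)%R /\
  forall Q, A Q ->
    (exists S, [/\ A S, enlarge A Q `<=` S & mu S <= C%:E * mu Q]) /\
    ((mu setT <= C%:E * mu Q /\ A setT) \/
     (exists S, [/\ A S, Q `<=` S,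
                    2%:E * mu Q <= mu S & mu S <= C%:E * mu Q])).

Definition doubling_family A := exists C, doubling_family_with C A.

Definition dense_family A :=
  {ae mu, forall x, forall r : R, (0 < r)%R ->
    exists Q, [/\ A Q, Q x & diam Q <= r%:E]}.

(* The inverse is that of \bar R, so averages over sets of infinite measure
   vanish when f is integrable. *)
Definition average f Q : \bar R := (mu Q)^-1 * \int[mu]_(y in Q) `|(f y)%:E|.

(* When no set of A contains x this is -oo instead of 0, which changes neither
   the sets [maximal A f > lambda], lambda > 0, nor limits along a dense
   family. *)
Definition maximal A f (x : M) : \bar R :=
  ereal_sup [set average f Q | Q in [set Q | A Q /\ Q x]].

(* The superlevel sets of maximal A f are unions of possibly uncountably many
   sets of A, so their measurability is not available: they are measured by
   the outer measure of mu, which coincides with mu on measurable sets. *)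
Definition maximal_weak_type11 A :=
  exists C : R, forall f, mu.-integrable setT (EFin \o f) ->
    forall lambda : R, (0 < lambda)%R ->
      mu_ext mu [set x | lambda%:E < maximal A f x] <=
        (C / lambda)%:E * 'N[mu]_1[EFin \o f].

Definition calderon_zygmund_decomposition C f (lambda : R) (f_ : nat -> M -> R)
    g (Q : nat -> set M) (r : nat -> R) (x : nat -> M) :=
  [/\ [/\ forall i, mu.-integrable setT (EFin \o f_ i),
          measurable_fun setT g,
          forall i, measurable (Q i),
          forall i, (0 < r i)%R &
          {ae mu, forall y, (\sum_(0 <= i < n) f_ i y)%R @[n --> \oo] -->
                            (f y - g y)%R}],
      forall i y, ~ Q i y -> f_ i y = 0%R,
      forall i, \int[mu]_y (f_ i y)%:E = 0,
      forall i, Q i `<=` ball (x i) (C * r i)%R &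
      [/\ \sum_(i <oo) mu [set y | dist_set y (Q i) < (r i)%:E] <=
            C%:E * ('N[mu]_1[EFin \o f] / lambda%:E),
          \sum_(i <oo) 'N[mu]_1[EFin \o f_ i] <= C%:E * 'N[mu]_1[EFin \o f] &
          forall y, (`|g y| <= C * lambda)%R]].

(* A finite decomposition is encoded by f_ i = 0 and Q i = set0 for large i,
   and if mu setT = +oo then the lower bound on lambda is 0. *)
Definition calderon_zygmund_property :=
  exists2 C : R, (0 < C)%R &
    forall f, mu.-integrable setT (EFin \o f) ->
    forall lambda : R,
      C%:E * ('N[mu]_1[EFin \o f] / mu setT) < lambda%:E ->
      exists (f_ : nat -> M -> R) (g : M -> R) (Q : nat -> set M)
             (r : nat -> R) (x : nat -> M),
        calderon_zygmund_decomposition C f lambda f_ g Q r x.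

End doubling.

Arguments borel_space {d R} M.

(* Main.v *)
Require Import Defs.
From HB Require Import structures.
From mathcomp Require Import all_boot all_order all_algebra.
From mathcomp Require Import all_classical all_reals all_analysis.
From mathcomp Require Import measurable_realfun lra.

Set Implicit Arguments.
Unset Strict Implicit.
Unset Printing Implicit Defensive.

Import Order.TTheory GRing.Theory Num.Theory.
Import numFieldNormedType.Exports.

Local Open Scope classical_set_scope.
Local Open Scope ring_scope.
Local Open Scope ereal_scope.

(** All three parts rest on one covering argument, of Vitali type, in which the
measure of a set plays the role of the radius of a ball.  From any collection
of sets with averages of |f| above lambda, pick repeatedly a set of almost
maximal measure among those disjoint from the sets picked before.  The picked
sets are disjoint, so their measures sum to at most |f|_1 / lambda; hence the
greedy choice exhausts the collection, in the sense that every set of the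
collection meets a picked set of at least half its measure
([greedy_disjoint_selection], [high_average_selection]).  The doubling
condition encloses all the sets that meet a given picked set F and have measure
at most 2 mu(F) in one set of measure at most C mu(F).

Weak type (1,1) follows at once, in the form of a measurable set that contains
the superlevel set of the maximal function ([maximal_superlevel_cover]).

For the differentiation theorem, call E invisible from outside for u when, at
almost every point outside E, the averages of u 1_E over small sets tend to 0.
Closed sets are invisible, as small sets around an outside point miss them; the
property passes to countable intersections by monotonicity, and to countable
unions by finite subadditivity plus the maximal inequality for the tail, the
tail being small in L^1.  The sets that are invisible together with their
complements therefore form a sigma-algebra that contains the open sets, which
are countable unions of closed sets, so all Borel sets are invisible
([measurable_invisible_outside]).  Consequently the averages of an integrable
function vanish almost everywhere on its zero set.  Applied to (|f| - q)^+ and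
to (q - |f|)^+ cut off by a ball, with q rational, this squeezes the averages
of |f| between values close to |f(x)| ([averages_differentiate]).

For the Calderon-Zygmund decomposition, the covering argument is run on stopping
sets: sets whose average exceeds lambda while the average over a container, of
comparable measure and enclosing all the relevant intersecting sets, is at most
lambda.  Every set with high average lies in a stopping set, since the
containers at least double the measure whereas sets with high average have
measure at most |f|_1 / lambda ([exists_stopping_set]).  The containers S_k of
the picked stopping sets F_k cover all sets with high average, and off their
union |f| <= lambda almost everywhere by differentiation.  Their union is cut
into disjoint pieces E_k with F_k <= E_k <= S_k; the bad functions are
(f - a_k) 1_(E_k), where a_k is the mean of f on E_k, and the good function is
a_k on E_k and f elsewhere. *)

(** * Greedy selection of disjoint sets *)

Section greedy.
Context {d : measure_display} {R : realType} {T : measurableType d}.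
Variable mu : {measure set T -> \bar R}.

Lemma half_sup_adherent (S : set (\bar R)) (K : R) :
  (forall x, S x -> 0 < x <= K%:E) -> S !=set0 ->
  exists2 x, S x & forall y, S y -> y <= 2%:E * x.
Proof.
move=> S0K [x0 Sx0]; set s := ereal_sup S.
have s0 : 0 < s.
  by apply: (@lt_le_trans _ _ x0); [have /andP[] := S0K _ Sx0 | exact: ereal_sup_ubound].
have sK : s <= K%:E by apply: ge_ereal_sup => x /S0K/andP[].
have sfin : s \is a fin_num by rewrite fin_numElt (lt_trans _ s0)//= (le_lt_trans sK) ?ltry.
have [x Sx] : exists2 x, S x & 2^-1%:E * s < x.
  apply: ereal_sup_gt; rewrite -/s -(fineK sfin) -EFinM lte_fin.
  have : (0 < fine s)%R by rewrite fine_gt0// s0 ltey_eq sfin.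
  lra.
move=> sx; exists x => // y Sy.
by rewrite -lee_pdivrMl ?ltr0n// (le_trans _ (ltW sx))// lee_pmul2l ?ltr0n// ereal_sup_ubound.
Qed.

(** The bound K on the total measure of disjoint families serves twice: it makes
the suprema in the greedy choice finite, and it forces the measures of the
selected sets to zero.  A set of B that missed all of them would stay available
for ever, which would keep these measures above half of its own.  The sequence
is padded by the empty set once no candidate is left. *)
Lemma greedy_disjoint_selection (B : set (set T)) (K : R) :
  (forall Q, B Q -> 0 < mu Q) ->
  (forall F : (set T)^nat, (forall n, B (F n) \/ F n = set0) ->
    trivIset setT F -> \sum_(n <oo) mu (F n) <= K%:E) ->
  exists F : (set T)^nat,
    [/\ forall n, B (F n) \/ F n = set0, trivIset setT F &
        forall Q, B Q -> exists n,
          [/\ B (F n), F n `&` Q !=set0 & mu Q <= 2%:E * mu (F n)]].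
Proof.
move=> B0 BK.
have BleK Q : B Q -> mu Q <= K%:E.
  (* the family reduced to Q, padded by the empty set *)
  move=> BQ; pose F n := if n is 0%N then Q else set0.
  have /BK : forall n, B (F n) \/ F n = set0 by case=> [|n]; [left|right].
  have tF : trivIset setT F.
    by apply/trivIsetP => -[|i] [|j]//= _ _ _; rewrite ?setI0 ?set0I.
  move=> /(_ tF); apply: le_trans.
  have := @nneseries_lim_ge R (fun n => mu (F n)) xpredT 0%N 1%N.
  by rewrite big_nat1; apply => n _ _; exact: measure_ge0.
(* U is the union of the sets selected so far *)
have pickP (U : set T) : exists P, [/\ B P \/ P = set0, P `&` U = set0 &
    forall Q, B Q -> Q `&` U = set0 -> mu Q <= 2%:E * mu P].
  have [/forallNP none|] := pselect (~ exists Q, B Q /\ Q `&` U = set0).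
    exists set0; split; [by right|exact: set0I|].
    by move=> Q BQ QU; exfalso; apply: (none Q).
  move=> /contrapT[Q0 [BQ0 Q0U]].
  have [||_ [P [BP PU] <-] Pmax] := @half_sup_adherent
      [set mu Q | Q in [set Q | B Q /\ Q `&` U = set0]] K.
  - by move=> _ [Q [BQ _] <-]; rewrite B0//= BleK.
  - by exists (mu Q0), Q0.
  exists P; split=> //; first by left.
  by move=> Q BQ QU; apply: Pmax; exists Q.
have [pick pickE] := choice pickP.
pose U := fix U n := if n is n'.+1 then U n' `|` pick (U n') else set0.
pose F n := pick (U n).
have subU i j : (i < j)%N -> F i `<=` U j.
  elim: j => // j IH; rewrite ltnS leq_eqVlt => /predU1P[->|/IH ij] x Fx /=.
    by right.
  by left; exact: ij.
have UF n x : U n x -> exists2 i, (i < n)%N & F i x.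
  elim: n => //= n IH [/IH[i ni Fi]|Fn]; last by exists n.
  by exists i => //; exact: ltnW.
have FB n : B (F n) \/ F n = set0 by have [] := pickE (U n).
have tF : trivIset setT F.
  apply/trivIsetP => i j _ _; wlog ij : i j / (i < j)%N => [H|_].
    rewrite neq_ltn => /orP[ij|ji]; first by apply: H => //; rewrite ltn_eqF.
    by rewrite setIC; apply: H => //; rewrite ltn_eqF.
  rewrite -subset0 => x [Fix Fjx].
  have [_ /seteqP[+ _] _] := pickE (U j); apply.
  by split; [exact: Fjx|exact: subU Fix].
exists F; split=> // Q BQ.
have [n [mQ hit]] : exists n, mu Q <= 2%:E * mu (F n) /\ F n `&` Q !=set0.
  have [/forallNP miss|/contrapT[n0 hit0]] := pselect (~ exists n, F n `&` Q !=set0).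
    exfalso.
    have QU n : Q `&` U n = set0.
      by rewrite -subset0 => x [Qx /UF[i _ Fx]]; apply: (miss i); exists x.
    have big n : 2^-1%:E * mu Q <= mu (F n).
      by rewrite lee_pdivrMl//; have [_ _] := pickE (U n); apply.
    have Qfin : mu Q \is a fin_num by rewrite ge0_fin_numE// (le_lt_trans (BleK _ BQ))// ltry.
    have q0 : (0 < fine (mu Q))%R by rewrite fine_gt0// B0// ltey_eq Qfin.
    have partial n : (2^-1 * fine (mu Q) *+ n <= K)%R.
      rewrite -lee_fin; apply: le_trans (BK _ FB tF).
      apply: (@le_trans _ _ (\sum_(0 <= i < n) mu (F i))); last first.
        by apply: nneseries_lim_ge => *; exact: measure_ge0.
      rewrite -[n in leLHS]subn0 -sumr_const_nat -sumEFin; apply: lee_sum => i _.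
      by rewrite EFinM fineK.
    have h0 : (0 < 2^-1 * fine (mu Q))%R by rewrite mulr_gt0.
    pose N := (Num.bound `|K / (2^-1 * fine (mu Q))|%R).
    have : (K / (2^-1 * fine (mu Q)) < N%:R)%R.
      by rewrite (le_lt_trans (ler_norm _))// /N archi_boundP.
    by rewrite ltr_pdivrMr// mulr_natl ltNge partial.
  (* the first selected set that meets Q was selected while Q was available *)
  have ex0 : exists n, `[< F n `&` Q !=set0 >] by exists n0; exact/asboolP.
  case: (ex_minnP ex0) => n /asboolP hit first_hit; exists n; split => //.
  have [_ _] := pickE (U n); apply=> //.
  rewrite -subset0 => x [Qx /UF[i ni Fx]].
  have : (n <= i)%N by apply: first_hit; apply/asboolP; exists x.
  by rewrite leqNgt ni.
exists n; split => //; case: (FB n) => // Fn0.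
by move: hit => [x []]; rewrite Fn0.
Qed.

End greedy.

(** * Metric and measure-theoretic preliminaries *)

Section metric_sets.
Context {R : realType} {M : metricType R}.
Implicit Types (Q S U : set M) (x y : M).

Lemma mdist_le_diam Q x y : Q x -> Q y -> (mdist x y)%:E <= diam Q.
Proof. by move=> Qx Qy; apply: ereal_sup_ubound; exists (x, y). Qed.

Lemma metric_ball_open x (r : R) : open (ball x r).
Proof.
rewrite openE => y; rewrite ballEmdist /= => xy; rewrite /interior -nbhs_ballE.
exists (r - mdist x y)%R; first by rewrite /= subr_gt0.
move=> z; rewrite !ballEmdist /= => yz.
by rewrite (le_lt_trans (metric_triangle x y z))// -ltrBrDl.
Qed.

Lemma small_set_sub_open U x : open U -> U x ->
  exists2 delta : R, (0 < delta)%R &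
    forall Q, Q x -> diam Q <= delta%:E -> Q `<=` U.
Proof.
rewrite openE => oU /oU; rewrite /interior -nbhs_ballE => -[e /= e0 eU].
exists (e / 2)%R; first by rewrite divr_gt0.
move=> Q Qx dQ y Qy; apply: eU; rewrite ballEmdist /=.
have := le_trans (mdist_le_diam Qx Qy) dQ; rewrite lee_fin.
by move=> /le_lt_trans; apply; lra.
Qed.

Lemma open_bigcup_closed U : open U ->
  exists2 F : (set M)^nat, (forall n, closed (F n)) & U = \bigcup_n F n.
Proof.
move=> oU; exists (fun n => ~` \bigcup_(y in ~` U) ball y n.+1%:R^-1).
  by move=> n; apply: open_closedC; apply: bigcup_open => *; exact: metric_ball_open.
apply/seteqP; split=> [x Ux|x [n _]]; last first.
  apply: contra_notP => nUx; exists x => //; rewrite ballEmdist /= mdistxx.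
  by rewrite invr_gt0.
move: (oU); rewrite openE => /(_ _ Ux); rewrite /interior -nbhs_ballE => -[e /= e0 eU].
have [n ne] := ltr_add_invr e0; rewrite add0r in ne.
exists n => // -[y nUy]; rewrite ballEmdist /= => yx; apply: nUy; apply: eU.
by rewrite ballEmdist /= metric_sym (lt_trans yx).
Qed.

Lemma dist_set_ltP y S (r : R) :
  (dist_set y S < r%:E) <-> exists2 s, S s & (mdist y s < r)%R.
Proof.
split=> [/ereal_inf_lt[_ [s Ss <-]]|[s Ss ysr]]; first by rewrite lte_fin; exists s.
apply: (@le_lt_trans _ _ (mdist y s)%:E); last by rewrite lte_fin.
by apply: ereal_inf_lbound; exists s.
Qed.

Lemma open_dist_set_lt S (r : R) : open [set y | dist_set y S < r%:E].
Proof.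
rewrite (_ : [set _ | _] = \bigcup_(s in S) ball s r).
  by apply: bigcup_open => s _; exact: metric_ball_open.
apply/seteqP; split=> [y /dist_set_ltP[s Ss ysr]|y [s Ss]].
  by exists s => //; rewrite ballEmdist /= metric_sym.
by rewrite ballEmdist /= => syr; apply/dist_set_ltP; exists s => //; rewrite metric_sym.
Qed.

(** This makes continuity from above available for the measure of closed
neighbourhoods. *)
Lemma dist_set_leE S (r : R) : [set y | dist_set y S <= r%:E] =
  \bigcap_n [set y | dist_set y S < (r + n.+1%:R^-1)%:E].
Proof.
apply/seteqP; split=> [y /= yr n _|y /= yr].
  by apply: (le_lt_trans yr); rewrite lte_fin ltrDl invr_gt0.
apply/lee_addgt0Pr => e e0; have [n ne] := ltr_add_invr e0; rewrite add0r in ne.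
by apply: (le_trans (ltW (yr n I))); rewrite -EFinD lee_fin lerD2l ltW.
Qed.

End metric_sets.

(** The lower bound on the height lambda, freed from the division by the total
measure m, which may be 0 or infinite. *)
Lemma level_bounds {R : realType} (c n lambda : R) (m : \bar R) :
  (0 < c)%R -> (0 <= n)%R ->
  0 <= m -> (m = 0 -> n = 0%R) -> c%:E * (n%:E / m) < lambda%:E ->
  (0 < lambda)%R /\ (c * n)%:E <= lambda%:E * m.
Proof.
move=> c0 n0 m0 mn cl.
have l0 : (0 < lambda)%R.
  rewrite -lte_fin; apply: le_lt_trans cl; rewrite mule_ge0 ?mule_ge0 ?inve_ge0 ?lee_fin//.
  exact: ltW.
split=> //; move: m m0 mn cl => [m| |]//.
  rewrite lee_fin le_eqVlt => /predU1P[<- /(_ erefl) -> _|m0 _].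
    by rewrite mulr0 mule0.
  rewrite inver gt_eqF// -!EFinM lte_fin lee_fin mulrA.
  by rewrite ltr_pdivrMr// => /ltW.
by move=> _ _ _; rewrite gt0_muley ?leey// lte_fin.
Qed.

Section negligible_facts.
Context {d : measure_display} {R : realType} {T : measurableType d}.
Variable mu : {measure set T -> \bar R}.

Lemma negligible_small_cover (X : set T) :
  (forall e : R, (0 < e)%R -> exists E, [/\ measurable E, X `<=` E & mu E <= e%:E]) ->
  mu.-negligible X.
Proof.
move=> small; have sm n : exists E, [/\ measurable E, X `<=` E & mu E <= (n.+1%:R^-1)%:E].
  by apply: small; rewrite invr_gt0.
have [E EP] := choice sm; have mE n : measurable (E n) by have [] := EP n.
exists (\bigcap_n E n); split; last 1 first.
- by move=> x Xx n _; have [_ + _] := EP n; apply.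
- exact: bigcapT_measurable.
apply/eqP; rewrite eq_le measure_ge0 andbT; apply/lee_addgt0Pr => e e0.
have [n ne] := ltr_add_invr e0; rewrite add0r in ne.
rewrite add0e (@le_trans _ _ (mu (E n)))//.
  by apply: le_measure; rewrite ?inE//; [exact: bigcapT_measurable|exact: bigcap_inf].
by have [_ _ /le_trans] := EP n; apply; rewrite lee_fin ltW.
Qed.

Lemma ae_forall_rat (P : rat -> T -> Prop) :
  (forall q, {ae mu, forall x, P q x}) -> {ae mu, forall x, forall q, P q x}.
Proof.
move=> aeP.
have : {ae mu, forall x, forall n, if @unpickle rat n is Some q then P q x else True}.
  apply: ae_foralln => n; case: (unpickle n) => [q|]; first exact: aeP.
  exact: aeW.
by apply: filterS => x Px q; have := Px (pickle q); rewrite pickleK.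
Qed.

End negligible_facts.

(** Each F n keeps its own points; a point of the union of the S n that lies in no
F k goes to the first S n that contains it. *)
Lemma disjoint_refinement {d : measure_display} {T : measurableType d}
    (F S : (set T)^nat) :
  (forall n, measurable (F n)) -> (forall n, measurable (S n)) ->
  (forall n, F n `<=` S n) -> trivIset setT F ->
  exists E : (set T)^nat, [/\ forall n, measurable (E n), trivIset setT E,
    forall n, F n `<=` E n, forall n, E n `<=` S n &
    \bigcup_n E n = \bigcup_n S n].
Proof.
move=> mF mS FS tF; pose E n := F n `|` (seqDU S n `\` \bigcup_k F k).
have ES n : E n `<=` S n.
  by move=> x [Fx|[Sx _]]; [exact: FS|exact: subset_seqDU Sx].
exists E; split=> //.
- move=> n; apply: measurableU => //; apply: measurableD; last exact: bigcup_measurable.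
  exact: seqDU_measurable.
- move=> i j _ _ [x [[Fi|[Si nFi]] [Fj|[Sj nFj]]]].
  + by apply: tF => //; exists x.
  + by exfalso; apply: nFj; exists i.
  + by exfalso; apply: nFi; exists j.
  + by apply: (@trivIset_seqDU _ S) => //; exists x.
- by move=> n x Fx; left.
apply/seteqP; split=> [x [n _ Ex]|x]; first by exists n => //; exact: ES.
have [[k _ Fx] _|nF] := pselect ((\bigcup_k F k) x); first by exists k => //; left.
by rewrite seqDU_bigcup_eq => -[n _ Sx]; exists n => //; right.
Qed.

Lemma measurable_piecewise_cst {d : measure_display} {R : realType}
    {T : measurableType d} (E : (set T)^nat) (a : nat -> R) (h : T -> R) :
  (forall n, measurable (E n)) -> trivIset setT E -> measurable_fun setT h ->
  exists2 g : T -> R, measurable_fun setT g &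
    (forall n y, E n y -> g y = a n) /\
    (forall y, ~ (\bigcup_n E n) y -> g y = h y).
Proof.
move=> mE tE mh.
have gP (y : T) : exists v : R, (forall n, E n y -> v = a n) /\
    (~ (\bigcup_n E n) y -> v = h y).
  have [[n _ Eny]|nEy] := pselect ((\bigcup_n E n) y).
    exists (a n); split=> [m Emy|[]]; last by exists n.
    by congr a; apply: tE => //; exists y.
  by exists (h y); split=> // n Eny; exfalso; apply: nEy; exists n.
have [g gE] := choice gP.
have gEn n y : E n y -> g y = a n by move=> Eny; have [+ _] := gE y; apply.
have gh y : ~ (\bigcup_n E n) y -> g y = h y by have [] := gE y.
exists g => //.
have mUE : measurable (\bigcup_n E n) by exact: bigcup_measurable.
rewrite -(setUv (\bigcup_n E n)); apply/measurable_funU => //; first exact: measurableC.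
split.
  apply/measurable_fun_bigcup => // n.
  apply: (@eq_measurable_fun _ _ _ _ _ (cst (a n))) => // y.
  by rewrite inE => /gEn.
apply: (@eq_measurable_fun _ _ _ _ _ h); last exact: measurable_funTS.
by move=> y; rewrite inE => /gh.
Qed.

(** * Averages *)

Section averages.
Context {d : measure_display} {R : realType} {M : metricMeasurableType d R}.
Variable mu : {measure set M -> \bar R}.
Implicit Types (f g h u : M -> R) (E Q : set M).

Lemma measurable_abs f (D : set M) : mu.-integrable setT (EFin \o f) ->
  measurable_fun D (fun y : M => `|(f y)%:E|).
Proof.
by move=> /measurable_int mf; apply: measurable_funTS; exact: measurableT_comp.
Qed.

Lemma le_integral_abs_setT f Q : mu.-integrable setT (EFin \o f) ->
  measurable Q -> \int[mu]_(y in Q) `|(f y)%:E| <= \int[mu]_y `|(f y)%:E|.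
Proof.
by move=> intf mQ; apply: ge0_subset_integral => //; exact: measurable_abs.
Qed.

Lemma integral_abs_lty f Q : mu.-integrable setT (EFin \o f) ->
  measurable Q -> \int[mu]_(y in Q) `|(f y)%:E| < +oo.
Proof.
move=> intf mQ; apply: (le_lt_trans (le_integral_abs_setT intf mQ)).
by have /integrableP[] := intf.
Qed.

(** When mu Q is infinite, the average is 0 and the right-hand bound is +oo, so
that the equivalence persists; in particular sets with high average have finite
measure. *)
Lemma average_le f Q (lambda : R) : (0 < lambda)%R ->
  mu.-integrable setT (EFin \o f) -> measurable Q -> 0 < mu Q ->
  (average mu f Q <= lambda%:E) =
  (\int[mu]_(y in Q) `|(f y)%:E| <= lambda%:E * mu Q).
Proof.
move=> l0 intf mQ; rewrite /average.
have Ifin : \int[mu]_(y in Q) `|(f y)%:E| \is a fin_num.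
  by rewrite ge0_fin_numE ?integral_abs_lty//; exact: integral_ge0.
case: (mu Q) => [m| |]//; rewrite ?lte_fin => m0.
  by rewrite inver gt_eqF// lee_pdivrMl// muleC.
by rewrite invey mul0e lee_fin (ltW l0) gt0_muley ?leey// lte_fin.
Qed.

Lemma average_gt f Q (lambda : R) : (0 < lambda)%R ->
  mu.-integrable setT (EFin \o f) -> measurable Q -> 0 < mu Q ->
  (lambda%:E < average mu f Q) =
  (lambda%:E * mu Q < \int[mu]_(y in Q) `|(f y)%:E|).
Proof. by move=> *; rewrite !ltNge average_le. Qed.

Lemma sum_integral_abs_le f (F : (set M)^nat) :
  mu.-integrable setT (EFin \o f) -> (forall n, measurable (F n)) ->
  trivIset setT F ->
  \sum_(n <oo) \int[mu]_(y in F n) `|(f y)%:E| <= \int[mu]_y `|(f y)%:E|.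
Proof.
move=> intf mF tF; rewrite -ge0_integral_bigcup//; last exact: measurable_abs.
by apply: le_integral_abs_setT => //; exact: bigcup_measurable.
Qed.

(** Chebyshev's inequality, summed: disjointness keeps the integrals over the F n
within a single integral of |f|. *)
Lemma sum_measure_high_average f (lambda : R) (F : (set M)^nat) :
  (0 < lambda)%R -> mu.-integrable setT (EFin \o f) ->
  (forall n, measurable (F n)) -> trivIset setT F ->
  (forall n, lambda%:E * mu (F n) <= \int[mu]_(y in F n) `|(f y)%:E|) ->
  \sum_(n <oo) mu (F n) <= lambda^-1%:E * \int[mu]_y `|(f y)%:E|.
Proof.
move=> l0 intf mF tF hF; rewrite lee_pdivlMl// -nneseriesZl//.
apply: le_trans (sum_integral_abs_le intf mF tF).
by apply: lee_nneseries => n _// _; rewrite mule_ge0// lee_fin ltW.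
Qed.

Lemma average_ge0 f Q : 0 <= average mu f Q.
Proof. by rewrite mule_ge0 ?inve_ge0//; exact: integral_ge0. Qed.

Lemma average_leD f g h Q : measurable Q ->
  measurable_fun setT f -> measurable_fun setT g -> measurable_fun setT h ->
  (forall y, Q y -> (`|f y| <= `|g y| + `|h y|)%R) ->
  average mu f Q <= average mu g Q + average mu h Q.
Proof.
move=> mQ mf mg mh fgh.
have mabs (u : M -> R) : measurable_fun setT u -> measurable_fun Q (fun y => `|(u y)%:E|).
  move=> mu_; apply: measurable_funTS.
  by apply: measurableT_comp => //; exact: measurableT_comp.
rewrite /average -ge0_muleDr; [|exact: integral_ge0|exact: integral_ge0].
rewrite -ge0_integralD//; [|exact: mabs|exact: mabs].
apply: lee_wpmul2l; first by rewrite inve_ge0.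
apply: ge0_le_integral => //; first exact: mabs.
by apply: emeasurable_funD; exact: mabs.
Qed.

Lemma average_cst (q : R) Q : measurable Q -> 0 < mu Q < +oo ->
  average mu (cst q) Q = `|q|%:E.
Proof.
move=> mQ /andP[Q0 Qoo]; rewrite /average.
rewrite (eq_integral (cst `|q|%:E)) ?integral_cst//.
have : mu Q \is a fin_num by rewrite ge0_fin_numE// ltW.
move: Q0 Qoo; case: (mu Q) => // m; rewrite lte_fin => m0 _ _.
by rewrite inver gt_eqF// -!EFinM mulrCA mulVf ?mulr1// gt_eqF.
Qed.

Lemma average_eq0 f Q : (forall y, Q y -> f y = 0%R) -> average mu f Q = 0.
Proof.
move=> f0; rewrite /average integral0_eq ?mule0// => y Qy.
by rewrite f0// abse0.
Qed.

Lemma integrable_patch f (E : set M) : measurable E ->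
  mu.-integrable setT (EFin \o f) -> mu.-integrable setT (EFin \o (f \_ E)).
Proof.
move=> mE intf; rewrite -restrict_EFin -(integrable_mkcond _ mE).
by apply: integrableS intf => //; exact: subsetT.
Qed.

Lemma integrable_measurable f :
  mu.-integrable setT (EFin \o f) -> measurable_fun setT f.
Proof. by move=> /measurable_int/measurable_EFinP. Qed.

Lemma abs_patch_setU u E E' (y : M) :
  (`|(u \_ (E `|` E')) y| <= `|(u \_ E) y| + `|(u \_ E') y|)%R.
Proof.
rewrite !patchE; case: ifPn => [|_]; last by rewrite normr0 addr_ge0.
rewrite inE => -[Ey|Ey].
  by rewrite mem_set// lerDl.
by rewrite [in X in (_ <= _ + X)%R]mem_set// lerDr.
Qed.

Lemma abs_patch_sub u E E' (y : M) : E `<=` E' ->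
  (`|(u \_ E) y| <= `|(u \_ E') y|)%R.
Proof.
move=> EE'; rewrite !patchE; case: ifPn => [|_]; last by rewrite normr0.
by rewrite inE => /EE' E'y; rewrite mem_set.
Qed.

(** The number a is the mean of f on E.  The third clause bounds it by the mean of
|f| and is stated without division, hence also for a null set E. *)
Lemma mean_correction f E : mu.-integrable setT (EFin \o f) ->
  measurable E -> mu E < +oo ->
  exists a : R, [/\
    mu.-integrable setT (EFin \o ((fun y => f y - a)%R \_ E)),
    \int[mu]_y (((fun y => f y - a)%R \_ E) y)%:E = 0,
    `|a|%:E * mu E <= \int[mu]_(y in E) `|(f y)%:E| &
    \int[mu]_y `|(((fun y => f y - a)%R \_ E) y)%:E| <=
      2%:E * \int[mu]_(y in E) `|(f y)%:E| ].
Proof.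
move=> intf mE Eoo.
have intfE : mu.-integrable E (EFin \o f).
  by apply: integrableS intf => //; exact: subsetT.
have Efin : mu E \is a fin_num by rewrite ge0_fin_numE.
have Ifin : \int[mu]_(y in E) (f y)%:E \is a fin_num by exact: integrable_fin_num.
pose a := (fine (\int[mu]_(y in E) (f y)%:E) / fine (mu E))%R.
have aE : a%:E * mu E = \int[mu]_(y in E) (f y)%:E.
  have [E0|E0] := eqVneq (mu E) 0.
    rewrite E0 mule0; apply/esym.
    by apply: null_set_integral => //; exact: measurable_int intfE.
  rewrite -(fineK Efin) -(fineK Ifin) -EFinM /a divfK// fine_eq0//.
have aI : `|a|%:E * mu E <= \int[mu]_(y in E) `|(f y)%:E|.
  rewrite -abse_EFin -{1}(gee0_abs (measure_ge0 mu E)) -abseM aE.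
  exact: le_abse_integral (measurable_int _ intfE).
have inta : mu.-integrable E (EFin \o cst a).
  by apply: measurable_bounded_integrable => //; exact: bounded_cst.
have intfa : mu.-integrable E (EFin \o (fun y => f y - a)%R).
  by rewrite (_ : _ \o _ = (EFin \o f) \- (EFin \o cst a))//; exact: integrableB.
exists a; split=> //.
- by rewrite -restrict_EFin -(integrable_mkcond _ mE).
- rewrite (eq_integral ((EFin \o (fun y => f y - a)%R) \_ E)); last first.
    by move=> y _; rewrite restrict_EFin.
  rewrite -integral_mkcond.
  rewrite (eq_integral (fun y => (f y)%:E - (cst a y)%:E))//.
  rewrite integralB_EFin// (_ : \int[mu]_(y in E) (cst a y)%:E = a%:E * mu E).
    by rewrite -aE subee// fin_numM.
  exact: (integral_cst _ mE a%:E).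
rewrite (eq_integral ((abse \o (EFin \o (fun y => f y - a)%R)) \_ E)); last first.
  by move=> y _; rewrite restrict_abse restrict_EFin.
rewrite -integral_mkcond mule_natl mule2n.
apply: (@le_trans _ _ (\int[mu]_(y in E) (`|(f y)%:E| + `|a|%:E))).
  apply: ge0_le_integral => //.
  - by move=> y _; exact: abse_ge0.
  - by apply: measurableT_comp => //; exact: measurable_int intfa.
  - apply: emeasurable_funD => //; apply: measurableT_comp => //; exact: measurable_int intfE.
  - by move=> y _; rewrite /= -EFinD lee_fin ler_normB.
rewrite ge0_integralD//; last first.
  by apply: measurableT_comp => //; exact: measurable_int intfE.
by rewrite integral_cst// leeD2l.
Qed.

End averages.

Section doubling_family.
Context {d : measure_display} {R : realType} {M : metricMeasurableType d R}.
Variable mu : {measure set M -> \bar R}.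
Hypothesis borelM : borel_space M.
Hypothesis ball_fin : forall (x : M) (r : R), mu (ball x r) < +oo.
Variable A : set (set M).
Hypothesis A_meas : forall Q, A Q -> measurable Q.
Hypothesis A_pos : forall Q, A Q -> 0 < mu Q.
Variable C : R.
Hypothesis A_doubling : doubling_family_with mu C A.
Implicit Types (f u : M -> R) (E P Q S : set M) (x : M).

(** * The maximal inequality *)

Lemma high_average_selection f (lambda : R) (B : set (set M)) :
  (0 < lambda)%R -> mu.-integrable setT (EFin \o f) ->
  B `<=` [set Q | A Q /\ lambda%:E < average mu f Q] ->
  exists F : (set M)^nat,
    [/\ forall n, B (F n) \/ F n = set0, trivIset setT F,
        \sum_(n <oo) mu (F n) <= lambda^-1%:E * \int[mu]_y `|(f y)%:E| &
        forall Q, B Q -> exists n,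
          [/\ B (F n), F n `&` Q !=set0 & mu Q <= 2%:E * mu (F n)]].
Proof.
move=> l0 intf BA.
have sumF (F : (set M)^nat) : (forall n, B (F n) \/ F n = set0) ->
    trivIset setT F ->
    \sum_(n <oo) mu (F n) <= lambda^-1%:E * \int[mu]_y `|(f y)%:E|.
  move=> BF tF; apply: sum_measure_high_average => // n.
    by case: (BF n) => [/BA[/A_meas]|->].
  case: (BF n) => [/BA[AF]|->]; last by rewrite measure0 mule0 integral_set0.
  by rewrite average_gt//; [exact: ltW|exact: A_meas|exact: A_pos].
have fin : lambda^-1%:E * \int[mu]_y `|(f y)%:E| \is a fin_num.
  by rewrite fin_numM// ge0_fin_numE ?integral_ge0// integral_abs_lty.
have [||F [BF tF hF]] := @greedy_disjoint_selection _ _ _ mu B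
    (fine (lambda^-1%:E * \int[mu]_y `|(f y)%:E|)).
- by move=> Q /BA[/A_pos].
- by move=> F BF tF; rewrite fineK// sumF.
by exists F; split => //; exact: sumF.
Qed.

(** A high-average set Q meets a selected F n with mu Q <= 2 mu (F n), so Q lies in
enlarge A (F n), and with it in the set S n that the doubling condition attaches
to F n.  A measurable cover, rather than a bound on the outer measure, is what
the null set arguments of the differentiation theorem use. *)
Lemma maximal_superlevel_cover f : mu.-integrable setT (EFin \o f) ->
  forall lambda : R, (0 < lambda)%R ->
  exists E, [/\ measurable E, [set x | lambda%:E < maximal mu A f x] `<=` E &
    mu E <= (C / lambda)%:E * \int[mu]_y `|(f y)%:E|].
Proof.
move=> intf lambda l0; have [C0 dA] := A_doubling.
pose B := [set Q | A Q /\ lambda%:E < average mu f Q].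
have [F [BF tF sumF hitF]] := @high_average_selection f lambda B l0 intf (fun=> id).
have contP n : exists S, [/\ measurable S, B (F n) -> enlarge mu A (F n) `<=` S &
    mu S <= C%:E * mu (F n)].
  have [BFn|nBFn] := pselect (B (F n)).
    have [[S [AS ? ?]] _] := dA _ (BFn.1).
    by exists S; split => //; exact: A_meas.
  by exists set0; split => //; rewrite measure0 mule_ge0// lee_fin ltW.
have [S SP] := choice contP.
have mS n : measurable (S n) by have [] := SP n.
exists (\bigcup_n S n); split.
- exact: bigcup_measurable.
- move=> x /= /ereal_sup_gt[_ [Q [AQ Qx] <-] lQ].
  have [n [BFn [z [Fz Qz]] muQ]] := hitF Q (conj AQ lQ).
  exists n => //; have [_ /(_ BFn) sub _] := SP n; apply: sub.
  by exists Q => //; split => //; exists z.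
- apply: (@le_trans _ _ (\sum_(n <oo) mu (S n))).
    by apply: measure_sigma_subadditive => //; exact: bigcup_measurable.
  apply: (@le_trans _ _ (\sum_(n <oo) C%:E * mu (F n))).
    by apply: lee_nneseries => // n _; have [] := SP n.
  rewrite nneseriesZl// EFinM -muleA lee_pmul2l// lte_fin.
Qed.

Lemma doubling_maximal_weak_type11 : maximal_weak_type11 mu A.
Proof.
exists C => f intf lambda l0; rewrite Lnorm1.
have [E [mE subE muE]] := maximal_superlevel_cover intf l0.
by apply: le_trans (le_mu_ext mu subE) _; rewrite measurable_mu_extE.
Qed.

(** * Differentiation of integrals *)

Lemma open_measurable_set (U : set M) : open U -> measurable U.
Proof. by rewrite borelM => oU; exact: sub_sigma_algebra. Qed.

Lemma closed_measurable_set (F : set M) : closed F -> measurable F.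
Proof.
by move=> cF; rewrite -[F]setCK; apply: measurableC; apply: open_measurable_set;
   exact: closed_openC.
Qed.

Definition locally_small_average f x (e : R) :=
  exists2 delta : R, (0 < delta)%R &
    forall Q, A Q -> Q x -> diam Q <= delta%:E -> average mu f Q <= e%:E.

Definition vanishing_averages f x :=
  forall e : R, (0 < e)%R -> locally_small_average f x e.

(** Measurability is included so that the class of such sets is directly
comparable with a sigma-algebra. *)
Definition invisible_outside u E := measurable E /\
  mu.-negligible [set x | ~ E x /\ ~ vanishing_averages (u \_ E) x].

Section fixed_function.
Variable u : M -> R.
Hypothesis intu : mu.-integrable setT (EFin \o u).

Let mpatch E : measurable E -> measurable_fun setT (u \_ E).
Proof. by move=> mE; apply: (@integrable_measurable _ _ _ mu); exact: integrable_patch. Qed.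

Let average_patch_leU E E' E0 Q : measurable Q -> measurable E ->
  measurable E' -> measurable E0 -> E0 `<=` E `|` E' ->
  average mu (u \_ E0) Q <= average mu (u \_ E) Q + average mu (u \_ E') Q.
Proof.
move=> mQ mE mE' mE0 sub; apply: average_leD => //; try exact: mpatch.
by move=> y _; apply: le_trans (abs_patch_setU _ _ _ _); exact: abs_patch_sub.
Qed.

Lemma vanishing_averages_sub E E' x : measurable E -> measurable E' ->
  E `<=` E' -> vanishing_averages (u \_ E') x -> vanishing_averages (u \_ E) x.
Proof.
move=> mE mE' EE' vE' e /vE'[delta d0 small]; exists delta => // Q AQ Qx dQ.
apply: le_trans (small Q AQ Qx dQ).
rewrite -[leRHS]adde0 -(@average_eq0 _ _ _ mu (u \_ set0) Q); last first.
  by move=> y _; rewrite patchE memNset.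
apply: average_patch_leU => //; first exact: A_meas.
by rewrite setU0.
Qed.

Lemma vanishing_averages_setU E E' x : measurable E -> measurable E' ->
  vanishing_averages (u \_ E) x -> vanishing_averages (u \_ E') x ->
  vanishing_averages (u \_ (E `|` E')) x.
Proof.
move=> mE mE' vE vE' e e0.
have e20 : (0 < e / 2)%R by rewrite divr_gt0.
have [delta d0 small] := vE _ e20; have [delta' d'0 small'] := vE' _ e20.
exists (Num.min delta delta'); first by rewrite lt_min d0.
move=> Q AQ Qx; rewrite EFin_min le_min => /andP[dQ dQ'].
rewrite (splitr e) EFinD; apply: (@le_trans _ _ (average mu (u \_ E) Q + average mu (u \_ E') Q)).
  by apply: average_patch_leU => //; [exact: A_meas|exact: measurableU].
by rewrite leeD ?small ?small'.
Qed.

Lemma invisible_outside_closed (F : set M) : closed F -> invisible_outside u F.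
Proof.
move=> cF; split; first exact: closed_measurable_set.
rewrite (_ : [set _ | _] = set0); first exact: negligible_set0.
rewrite -subset0 => x [nFx]; apply => e e0.
have [|delta d0 avoid] := @small_set_sub_open _ _ (~` F) x _ nFx.
  exact: closed_openC.
exists delta => // Q AQ Qx dQ; rewrite average_eq0 ?lee_fin ?ltW// => y Qy.
by rewrite patchE memNset//; exact: avoid Qy.
Qed.

(** A point outside the intersection lies outside some E n, where the larger
function u 1_(E n) already has vanishing averages. *)
Lemma invisible_outside_bigcap (E : (set M)^nat) :
  (forall n, invisible_outside u (E n)) -> invisible_outside u (\bigcap_n E n).
Proof.
move=> invE; have mE n : measurable (E n) by have [] := invE n.
split; first exact: bigcapT_measurable.
apply: negligibleS (negligible_bigcup (fun n => (invE n).2)) => x [nEx nv].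
have [n nEn] : exists n, ~ E n x.
  by apply/existsNP => allE; apply: nEx => n _; exact: allE.
exists n => //; split=> // vn; apply: nv.
apply: vanishing_averages_sub vn => //; first exact: bigcapT_measurable.
exact: bigcap_inf.
Qed.

Lemma invisible_outside_setU E E' :
  invisible_outside u E -> invisible_outside u E' -> invisible_outside u (E `|` E').
Proof.
move=> [mE nE] [mE' nE']; split; first exact: measurableU.
apply: negligibleS (negligibleU nE nE') => x [/not_orP[nEx nE'x] nv].
have [vE|] := pselect (vanishing_averages (u \_ E) x); last by left.
right; split=> // vE'; apply: nv; exact: vanishing_averages_setU.
Qed.

Lemma invisible_outside_set0 : invisible_outside u set0.
Proof. by apply: invisible_outside_closed; exact: closed0. Qed.

Lemma integral_abs_tail (E : (set M)^nat) : (forall n, measurable (E n)) ->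
  \int[mu]_y `|((u \_ (\bigcup_k E k `\` \big[setU/set0]_(k < n) E k)) y)%:E| @[n --> \oo] --> 0.
Proof.
move=> mE; rewrite -[X in _ --> X](@integral0 _ _ _ mu setT).
have mT n : measurable (\bigcup_k E k `\` \big[setU/set0]_(k < n) E k).
  by apply: measurableD; [exact: bigcup_measurable|exact: bigsetU_measurable].
apply: (@dominated_cvg _ _ _ mu setT _ _ _ (fun y : M => `|(u y)%:E|)) => //.
- by move=> n; apply: (@measurable_abs _ _ _ mu); exact: integrable_patch.
- move=> y _; apply: cvg_near_cst.
  have [[k _ Eky]|nEy] := pselect ((\bigcup_k E k) y); last first.
    by near=> n; rewrite patchE memNset ?abse0// => -[].
  near=> n; rewrite patchE memNset ?abse0// => -[_]; apply.
  rewrite -bigcup_mkord; exists k => //=.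
  by near: n; exact: nbhs_infty_gt.
- exact: integrable_abse.
- move=> n y _; rewrite abse_id !abse_EFin lee_fin -[leRHS](_ : `|(u \_ setT) y| = _)%R.
    exact: abs_patch_sub.
  by rewrite patch_setT.
Unshelve. all: by end_near. Qed.

(** Split the union into a finite part U n and a tail T n.  Where the averages of
u 1_(U n) vanish for all n, a persistent average above e forces the maximal
function of u 1_(T n) above e / 2, for every n; the measure of that set is
controlled by the L^1 norm of the tail, which tends to 0. *)
Lemma invisible_outside_bigcup (E : (set M)^nat) :
  (forall n, invisible_outside u (E n)) -> invisible_outside u (\bigcup_n E n).
Proof.
move=> invE; have mE n : measurable (E n) by have [] := invE n.
have mUE : measurable (\bigcup_n E n) by exact: bigcup_measurable.
split=> //.
pose U n := \big[setU/set0]_(k < n) E k.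
have invU n : invisible_outside u (U n).
  rewrite /U; apply: big_ind => //; first exact: invisible_outside_set0.
  exact: invisible_outside_setU.
have mU n : measurable (U n) by have [] := invU n.
pose T n := \bigcup_k E k `\` U n.
have mT n : measurable (T n) by exact: measurableD.
pose bad (e : R) := [set x | [/\ ~ (\bigcup_n E n) x,
  forall n, vanishing_averages (u \_ (U n)) x &
  ~ locally_small_average (u \_ (\bigcup_n E n)) x e]].
have bad_negl e : (0 < e)%R -> mu.-negligible (bad e).
  move=> e0; apply: negligible_small_cover => r r0.
  have C0 : (0 < C)%R by case: A_doubling.
  have e20 : (0 < e / 2)%R by rewrite divr_gt0.
  (* a tail so small that the maximal inequality at height e / 2 yields r *)
  have [n tail] : exists n, \int[mu]_y `|((u \_ (T n)) y)%:E| <= (r / (C / (e / 2)))%:E.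
    have rC0 : (0 < r / (C / (e / 2)))%R by rewrite !divr_gt0.
    have /fine_cvgP[fin /cvgrPdist_le /(_ _ rC0) near0] := integral_abs_tail mE.
    have [N _ HN] := filterI fin near0; exists N; have [finN] := HN N (leqnn N).
    rewrite /= sub0r normrN ger0_norm; last by rewrite fine_ge0// integral_ge0.
    by move=> ?; rewrite -(fineK finN) lee_fin.
  have [N [mN subN muN]] := maximal_superlevel_cover
    (integrable_patch (mT n) intu) e20.
  exists N; split=> //; last first.
    apply: (le_trans muN); rewrite -lee_pdivlMl; last by rewrite divr_gt0.
    apply: (le_trans tail).
    by rewrite -EFinM lee_fin mulrC.
  move=> x [nEx vU nsmall]; apply: subN => /=; rewrite ltNge; apply/negP => maxle.
  apply: nsmall; have [delta d0 small] := vU n _ e20.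
  exists delta => // Q AQ Qx dQ.
  apply: (@le_trans _ _ (average mu (u \_ (U n)) Q + average mu (u \_ (T n)) Q)).
    apply: average_patch_leU => //; first exact: A_meas.
    by rewrite /T setDE setUIr setUv setIT; exact: subsetUr.
  rewrite (splitr e) EFinD leeD ?small//; apply: le_trans maxle.
  by apply: ereal_sup_ubound; exists Q.
have null : mu.-negligible
    (\bigcup_n [set x | ~ U n x /\ ~ vanishing_averages (u \_ (U n)) x] `|`
     \bigcup_n bad n.+1%:R^-1%R).
  apply: negligibleU; apply: negligible_bigcup => n; first by have [] := invU n.
  by apply: bad_negl; rewrite invr_gt0.
apply: negligibleS null => x [nEx nv].
have nUx n : ~ U n x.
  by rewrite /U -bigcup_mkord => -[k _ Ekx]; apply: nEx; exists k.
have [vU|/existsNP[n nvU]] := pselect (forall n, vanishing_averages (u \_ (U n)) x); last first.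
  by left; exists n.
right; move/existsNP: nv => [e /not_implyP[e0 nsmall]].
have [n ne] := ltr_add_invr e0; rewrite add0r in ne.
exists n => //; split=> // -[delta d0 small]; apply: nsmall; exists delta => // Q AQ Qx dQ.
by apply: (le_trans (small Q AQ Qx dQ)); rewrite lee_fin ltW.
Qed.

(** Invisibility is not evidently stable under complement, so the induction on
Borel sets carries E and its complement together: complementation is then
trivial, and unions and intersections exchange roles. *)
Lemma measurable_invisible_outside E : measurable E -> invisible_outside u E.
Proof.
move=> mE; suff [] : invisible_outside u E /\ invisible_outside u (~` E) by [].
move: E mE; rewrite borelM; apply: smallest_sub.
  split.
  - split; first exact: invisible_outside_set0.
    by rewrite setC0; apply: invisible_outside_closed; exact: closedT.
  - by move=> E [iE iCE]; rewrite setTD setCK.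
  - move=> E iE; split; first by apply: invisible_outside_bigcup => n; have [] := iE n.
    by rewrite setC_bigcup; apply: invisible_outside_bigcap => n; have [] := iE n.
move=> U oU /=; split; last first.
  by apply: invisible_outside_closed; exact: open_closedC.
have [F cF ->] := open_bigcup_closed oU.
by apply: invisible_outside_bigcup => n; exact: invisible_outside_closed.
Qed.

End fixed_function.

Lemma vanishing_averages_ae u E : mu.-integrable setT (EFin \o u) ->
  measurable E -> (forall y, E y -> u y = 0%R) ->
  {ae mu, forall x, E x -> vanishing_averages u x}.
Proof.
move=> intu mE u0.
have [_] := measurable_invisible_outside intu (measurableC mE).
apply: negligibleS => x /= /not_implyP[Ex nv]; split; first by apply.
suff -> : u \_ (~` E) = u by [].
apply/funext => y; rewrite patchE; case: ifPn => //.
by rewrite notin_setE /= => /contrapT /u0.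
Qed.

Lemma measurable_metric_ball x (r : R) : measurable (ball x r).
Proof. exact/open_measurable_set/metric_ball_open. Qed.

Lemma measure_bounded_lty Q x (delta : R) : measurable Q -> Q x ->
  diam Q <= delta%:E -> mu Q < +oo.
Proof.
move=> mQ Qx dQ; apply: le_lt_trans (ball_fin x (delta + 1)%R).
apply: le_measure; rewrite ?inE//; first exact: measurable_metric_ball.
move=> y Qy; rewrite ballEmdist /=.
have := le_trans (mdist_le_diam Qx Qy) dQ; rewrite lee_fin.
by move=> /le_lt_trans; apply; rewrite ltrDl.
Qed.

Let measurable_norm f : measurable_fun setT f -> measurable_fun setT (fun y => `|f y|%R).
Proof. by move=> mf; exact: measurableT_comp. Qed.

(** Since |f| <= q + (|f| - q)^+, it suffices that the averages of the last term
vanish almost everywhere on its zero set, which is where |f| <= q. *)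
Lemma averages_eventually_le f (q : R) : mu.-integrable setT (EFin \o f) ->
  (0 < q)%R ->
  {ae mu, forall x, (`|f x| <= q)%R ->
    forall e : R, (0 < e)%R -> locally_small_average f x (q + e)}.
Proof.
move=> intf q0; have mf := integrable_measurable intf.
pose u y := Num.max (`|f y| - q)%R 0%R.
have u_ge0 y : (0 <= u y)%R by rewrite le_max lexx orbT.
have mu_ : measurable_fun setT u.
  by apply: measurable_maxr => //; apply: measurable_funB => //; exact: measurable_norm.
have intu : mu.-integrable setT (EFin \o u).
  apply: le_integrable intf => //; first exact/measurable_EFinP.
  move=> y _ /=; rewrite lee_fin ger0_norm// ge_max normr_ge0 andbT.
  by rewrite lerBlDr lerDl ltW.
have mE : measurable [set y | (`|f y| <= q)%R].
  have := measurable_fun_le measurableT (measurable_norm mf) (measurable_cst q).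
  by rewrite setTI.
have u0 y : (`|f y| <= q)%R -> u y = 0%R.
  by move=> fq; apply/max_idPr; rewrite subr_le0.
have := vanishing_averages_ae intu mE u0.
apply: filterS => x vu fxq e e0; have [delta d0 small] := vu fxq e e0.
exists delta => // Q AQ Qx dQ.
apply: (@le_trans _ _ (average mu (cst q) Q + average mu u Q)).
  apply: average_leD => //; [exact: A_meas|].
  move=> y _; rewrite (ger0_norm (u_ge0 y)) (gtr0_norm q0) -lerBlDl.
  by rewrite le_max lexx.
rewrite average_cst; last 2 first.
- exact: A_meas.
- by rewrite A_pos//= (measure_bounded_lty (A_meas AQ) Qx dQ).
by rewrite EFinD (gtr0_norm q0) leeD// small.
Qed.

(** Dual to the previous lemma, with (q - |f|)^+.  That function need not be
integrable, so it is cut off by the balls of integer radius around a base point;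
these cover the space, and a small set around a point of a ball stays in it. *)
Lemma averages_eventually_ge f (q : R) : mu.-integrable setT (EFin \o f) ->
  {ae mu, forall x, (q <= `|f x|)%R ->
    forall e : R, (0 < e)%R ->
    exists2 delta : R, (0 < delta)%R &
      forall Q, A Q -> Q x -> diam Q <= delta%:E ->
        (q - e)%:E <= average mu f Q}.
Proof.
move=> intf; have mf := integrable_measurable intf.
have [q0|q0] := leP q 0%R.
  apply: aeW => x _ e e0; exists 1%R => // Q _ _ _.
  by apply: le_trans (average_ge0 _ _ _); rewrite lee_fin subr_le0 (le_trans q0)// ltW.
pose v y := Num.max (q - `|f y|)%R 0%R.
have v_ge0 y : (0 <= v y)%R by rewrite le_max lexx orbT.
have mv : measurable_fun setT v.
  by apply: measurable_maxr => //; apply: measurable_funB => //; exact: measurable_norm.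
pose D n := ball (point : M) n%:R.
have mD n : measurable (D n) by exact: measurable_metric_ball.
pose w n := v \_ (D n).
have intw n : mu.-integrable setT (EFin \o w n).
  rewrite /w -restrict_EFin -(integrable_mkcond _ (mD n)).
  apply: measurable_bounded_integrable => //.
  - exact: ball_fin.
  - exact: measurable_funTS.
  exists q; split; first exact: num_real.
  move=> r qr y _ /=; rewrite ger0_norm// (le_trans _ (ltW qr))// ge_max (ltW q0) andbT.
  by rewrite lerBlDr lerDl.
have mE : measurable [set y | (q <= `|f y|)%R].
  have := measurable_fun_le measurableT (measurable_cst q) (measurable_norm mf).
  by rewrite setTI.
have w0 n y : (q <= `|f y|)%R -> w n y = 0%R.
  move=> fq; rewrite /w patchE; case: ifPn => // _.
  by apply/max_idPr; rewrite subr_le0.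
have : {ae mu, forall x, forall n, (q <= `|f x|)%R -> vanishing_averages (w n) x}.
  apply: ae_foralln => n.
  exact: (vanishing_averages_ae (intw n) mE (w0 n)).
apply: filterS => x vw qfx e e0.
pose n := Num.bound (mdist point x).
have Dnx : D n x.
  by rewrite /D ballEmdist /= /n archi_boundP// mdist_ge0.
have [delta d0 small] := vw n qfx e e0.
have [delta' d'0 inD] := small_set_sub_open (metric_ball_open _ _) Dnx.
exists (Num.min delta delta'); first by rewrite lt_min d0.
move=> Q AQ Qx; rewrite EFin_min le_min => /andP[dQ dQ'].
rewrite EFinB leeBlDr//.
apply: (@le_trans _ _ (average mu f Q + average mu (w n) Q)); last first.
  by rewrite leeD2l// small.
rewrite -(gtr0_norm q0) -(@average_cst _ _ _ mu q Q); last 2 first.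
- exact: A_meas.
- by rewrite A_pos//= (measure_bounded_lty (A_meas AQ) Qx dQ).
apply: average_leD => //; [exact: A_meas|exact: integrable_measurable (intw n)|].
move=> y Qy; rewrite /w patchE mem_set; last exact: inD Qy.
by rewrite (ger0_norm (v_ge0 y)) (gtr0_norm q0) -lerBlDl le_max lexx.
Qed.

Lemma averages_differentiate f : mu.-integrable setT (EFin \o f) ->
  {ae mu, forall x, forall e : R, (0 < e)%R ->
    exists2 delta : R, (0 < delta)%R &
      forall Q, A Q -> Q x -> diam Q <= delta%:E ->
        (`|f x| - e)%:E <= average mu f Q <= (`|f x| + e)%:E}.
Proof.
move=> intf.
have up : {ae mu, forall x, forall q : rat, (0 < ratr q :> R)%R -> (`|f x| <= ratr q)%R ->
    forall e : R, (0 < e)%R -> locally_small_average f x (ratr q + e)}.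
  apply: ae_forall_rat => q; have [q0|q0] := ltP 0%R (ratr q : R).
    by apply: filterS (averages_eventually_le intf q0) => x ? _.
  exact: aeW.
have lo := ae_forall_rat (fun q : rat => averages_eventually_ge (ratr q) intf).
apply: filterS2 up lo => x up lo e e0.
have e20 : (0 < e / 2)%R by rewrite divr_gt0.
have [q /[!in_itv]/= /andP[fq qf]] : exists q : rat, ratr q \in `]`|f x|, (`|f x| + e / 2)[%R.
  by apply: rat_in_itvoo; rewrite ltrDl.
have [p /[!in_itv]/= /andP[fp pf]] : exists p : rat, ratr p \in `](`|f x| - e / 2), `|f x|[%R.
  by apply: rat_in_itvoo; rewrite ltrBlDr ltrDl.
have [delta d0 small] := up q (le_lt_trans (normr_ge0 _) fq) (ltW fq) _ e20.
have [delta' d'0 large] := lo p (ltW pf) _ e20.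
exists (Num.min delta delta'); first by rewrite lt_min d0.
move=> Q AQ Qx; rewrite EFin_min le_min => /andP[dQ dQ'].
apply/andP; split.
  by apply: le_trans (large Q AQ Qx dQ'); rewrite lee_fin; lra.
by apply: (le_trans (small Q AQ Qx dQ)); rewrite lee_fin; lra.
Qed.

Lemma dense_family_maximal_cvg f : dense_family mu A ->
  mu.-integrable setT (EFin \o f) ->
  {ae mu, forall x,
    maximal mu (A `&` [set Q | diam Q <= r%:E]) f x @[r --> 0%R^'+] -->
      `|f x|%:E}.
Proof.
rewrite /dense_family => denseA intf.
apply: filterS2 denseA (averages_differentiate intf) => x denseA diff.
have bounds (e : R) : (0 < e)%R -> \forall r \near 0%R^'+,
    (`|f x| - e)%:E <= maximal mu (A `&` [set Q | diam Q <= r%:E]) f x <= (`|f x| + e)%:E.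
  move=> e0; have [delta d0 close] := diff e e0.
  near=> r.
  have r0 : (0 < r)%R by near: r; exact: nbhs_right_gt.
  have rd : (r < delta)%R by near: r; exact: nbhs_right_lt.
  have small Q : A Q -> Q x -> diam Q <= r%:E ->
      (`|f x| - e)%:E <= average mu f Q <= (`|f x| + e)%:E.
    by move=> AQ Qx dQ; apply: close => //; rewrite (le_trans dQ)// lee_fin ltW.
  apply/andP; split.
    have [Q [AQ Qx dQ]] := denseA r r0.
    have /andP[+ _] := small Q AQ Qx dQ; move=> /le_trans; apply.
    by apply: ereal_sup_ubound; exists Q.
  by apply: ge_ereal_sup => _ [Q [[AQ dQ] Qx] <-]; have /andP[] := small Q AQ Qx dQ.
apply/fine_cvgP; split.
  have := bounds 1%R ltr01; apply: filterS => r /andP[lo hi].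
  by rewrite fin_numElt (lt_le_trans _ lo) ?ltNyr//= (le_lt_trans hi) ?ltry.
apply/cvgrPdist_le => e e0; have := bounds e e0; apply: filterS => r /=.
case: (maximal _ _ _ _) => [m| |]//=; last by rewrite leye_eq andbF.
by rewrite !lee_fin ler_distlC.
Unshelve. all: by end_near. Qed.

(** * The Calderon-Zygmund decomposition *)

Let C_gt0 : (0 < C)%R. Proof. by case: A_doubling. Qed.

(* one bound for both cases of large_container: C when the container is the whole
   space, C * C after two steps of the doubling condition *)
Let K := (C + C * C)%R.

Let K_gt0 : (0 < K)%R. Proof. by rewrite addr_gt0// mulr_gt0. Qed.

Lemma member_nonempty Q : A Q -> Q !=set0.
Proof.
move=> AQ; apply/set0P/eqP => Q0; move: (A_pos AQ).
by rewrite Q0 measure0 ltxx.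
Qed.

Lemma le_double (x : \bar R) : 0 <= x -> x <= 2%:E * x.
Proof. by move=> x0; rewrite mule_natl mule2n leeDl. Qed.

Lemma member_sub_enlarge Q : A Q -> Q `<=` enlarge mu A Q.
Proof.
move=> AQ y Qy; exists Q => //=; split=> //; last exact: le_double.
by rewrite setIid; exact: member_nonempty.
Qed.

(** Go up to a set R that contains Q and at least doubles its measure, then to the
set S that encloses enlarge A R: in this way S contains everything relevant
around Q and also grows, which makes the iteration in the next lemma stop. *)
Lemma large_container Q : A Q -> exists P, [/\ A P, enlarge mu A Q `<=` P,
  mu P <= K%:E * mu Q & P = setT \/ 2%:E * mu Q <= mu P].
Proof.
move=> AQ; have [_ dA] := A_doubling.
have C0 : 0 <= C%:E by rewrite lee_fin ltW.
have [_ [[TQ AT]|[P [AP QP QleP PleQ]]]] := dA Q AQ.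
  exists setT; split=> //; last by left.
  apply: (le_trans TQ); rewrite lee_wpmul2r// lee_fin lerDl.
  by rewrite mulr_ge0// ltW.
have [[S [AS PS SleP]] _] := dA P AP.
have PsubS : P `<=` S by apply: subset_trans PS; exact: member_sub_enlarge.
exists S; split=> //.
- apply: subset_trans PS => y [W [AW [z [Wz Qz]] muW] Wy]; exists W => //=.
  split=> //; first by exists z; split=> //; exact: QP.
  apply: (le_trans muW); rewrite lee_wpmul2l//.
  by apply: le_measure; rewrite ?inE//; exact: A_meas.
- apply: (le_trans SleP); apply: (@le_trans _ _ (C%:E * (C%:E * mu Q))).
    by rewrite lee_wpmul2l.
  rewrite muleA -EFinM lee_wpmul2r// lee_fin lerDr.
  exact: ltW.
- right; apply: (le_trans QleP).
  by apply: le_measure; rewrite ?inE//; exact: A_meas.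
Qed.

Definition stopping_set f (lambda : R) Q :=
  [/\ A Q, lambda%:E < average mu f Q & exists P, [/\ A P,
    enlarge mu A Q `<=` P, mu P <= K%:E * mu Q & average mu f P <= lambda%:E]].

(** Among the sets of A above Q with high average, take W of measure more than half
the supremum.  If no set above Q were stopping, two containers in a row would
again have high average, and the second would have measure at least 4 mu W. *)
Lemma exists_stopping_set f (lambda : R) : (0 < lambda)%R ->
  mu.-integrable setT (EFin \o f) ->
  \int[mu]_y `|(f y)%:E| <= lambda%:E * mu setT ->
  forall Q, A Q -> lambda%:E < average mu f Q ->
  exists2 Q', stopping_set f lambda Q' & Q `<=` Q'.
Proof.
move=> l0 intf avgT Q AQ lQ; apply: contrapT => nostop2.
have nostop Q' : stopping_set f lambda Q' -> ~ Q `<=` Q'.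
  by move=> sQ' QQ'; apply: nostop2; exists Q'.
pose up W := [/\ A W, Q `<=` W & lambda%:E < average mu f W].
have up_container W : up W -> exists P, up P /\ 2%:E * mu W <= mu P.
  move=> [AW QW lW]; have [P [AP WP muP large]] := large_container AW.
  have lP : lambda%:E < average mu f P.
    rewrite ltNge; apply/negP => Pl; apply: (nostop W) => //.
    by split=> //; exists P.
  exists P; split.
    split=> //; apply: subset_trans QW _.
    by apply: subset_trans WP; exact: member_sub_enlarge.
  case: large => // PT; move: lP; rewrite ltNge average_le//; last 2 first.
  - exact: A_meas.
  - exact: A_pos.
  by rewrite PT avgT.
have up_bounded W : up W -> mu W <= (lambda^-1 * fine (\int[mu]_y `|(f y)%:E|))%:E.
  move=> [AW _]; rewrite average_gt//; last 2 first.
  - exact: A_meas.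
  - exact: A_pos.
  move=> /ltW lW; rewrite EFinM fineK; last first.
    by rewrite ge0_fin_numE ?integral_ge0// integral_abs_lty.
  rewrite lee_pdivlMl//; apply: (le_trans lW).
  by apply: le_integral_abs_setT => //; exact: A_meas.
have [||_ [W upW <-] Wmax] := @half_sup_adherent _ [set mu W | W in up]
    (lambda^-1 * fine (\int[mu]_y `|(f y)%:E|))%R.
- move=> _ [W upW <-]; rewrite up_bounded// andbT.
  by case: upW => AW _ _; exact: A_pos.
- by exists (mu Q), Q => //; split.
have [P [upP WP]] := up_container _ upW.
have [P' [upP' PP']] := up_container _ upP.
have {}Wmax : mu P' <= 2%:E * mu W by apply: Wmax; exists P'.
have : 2%:E * (2%:E * mu W) <= 2%:E * mu W.
  by apply: le_trans Wmax; apply: le_trans PP'; rewrite lee_wpmul2l.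
rewrite lee_pmul2l// leNgt => /negP; apply.
have W0 : 0 < mu W by case: upW => AW _ _; exact: A_pos.
have Wfin : mu W \is a fin_num.
  by rewrite ge0_fin_numE// (le_lt_trans (up_bounded _ upW))// ltry.
move: W0; rewrite -(fineK Wfin) -EFinM !lte_fin.
lra.
Qed.

(** The doubling condition controls the closed neighbourhood of radius diam S / D;
by continuity from above it controls a slightly larger open neighbourhood with
a slightly larger constant.  The strict enlargement also covers diam S = 0, where
a positive radius is required, and makes the inclusion in an open ball hold. *)
Lemma doubling_neighbourhood (D : R) S : (0 < D)%R -> measurable S ->
  S !=set0 -> 0 < mu S < +oo -> diam S < +oo -> doubling_set mu D S ->
  exists r x, [/\ (0 < r)%R, S `<=` ball x (D * r)%R &
    mu [set y | dist_set y S < r%:E] <= (D + 1)%:E * mu S].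
Proof.
move=> D0 mS [x Sx] /andP[S0 Soo] dS doubS.
have dS0 : 0 <= diam S.
  by apply: le_trans (mdist_le_diam Sx Sx); rewrite mdistxx.
have dSfin : diam S \is a fin_num by rewrite ge0_fin_numE.
have Sfin : mu S \is a fin_num by rewrite ge0_fin_numE// ltW.
pose delta := fine (diam S).
have delta0 : (0 <= delta)%R by rewrite fine_ge0.
pose r n := (D^-1 * delta + n.+1%:R^-1)%R.
have r0 n : (0 < r n)%R by rewrite ltr_wpDl// mulr_ge0// invr_ge0 ltW.
pose F n := [set y | dist_set y S < (r n)%:E].
have mF n : measurable (F n).
  exact/open_measurable_set/open_dist_set_lt.
have in_ball y : S y -> (mdist x y <= delta)%R.
  by move=> Sy; rewrite -lee_fin fineK// mdist_le_diam.
have [n muFn] : exists n, mu (F n) <= (D + 1)%:E * mu S.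
  apply: contrapT => /forallNP big.
  have : mu (\bigcap_n F n) <= D%:E * mu S.
    rewrite -dist_set_leE; move: doubS; rewrite /doubling_set.
    by rewrite -(fineK dSfin) -EFinM.
  apply/negP; rewrite -ltNge; apply: (@lt_le_trans _ _ ((D + 1)%:E * mu S)).
    rewrite -(fineK Sfin) -!EFinM lte_fin ltr_pM2r ?ltrDl//.
    by rewrite fine_gt0// S0 ltey_eq Sfin.
  have cvgF : mu \o F @ \oo --> mu (\bigcap_n F n).
    apply: nonincreasing_cvg_mu => //.
    - apply: le_lt_trans (ball_fin x (r 0%N + delta)%R).
      apply: le_measure; rewrite ?inE//; first exact: measurable_metric_ball.
      move=> y /dist_set_ltP[s Ss ysr]; rewrite ballEmdist /= metric_sym.
      rewrite (le_lt_trans (metric_triangle y s x))// ltr_leD//.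
      by rewrite metric_sym in_ball.
    - exact: bigcapT_measurable.
    - apply/nonincreasing_seqP => n; apply/subsetPset => y /lt_trans; apply.
      by rewrite lte_fin ltrD2l ltf_pV2 ?posrE// ltr_nat.
  by apply: cvge_ge cvgF; near=> n; rewrite ltW// ltNge; exact/negP/big.
exists (r n), x; split=> // y Sy; rewrite ballEmdist /=.
rewrite (le_lt_trans (in_ball y Sy))// /r mulrDr mulrA divff ?gt_eqF// mul1r.
by rewrite ltrDl mulr_gt0.
Unshelve. all: by end_near. Qed.

(** Beyond unfolding the definition, this excludes containers of infinite diameter:
the doubling condition would bound the measure of the whole space by
D * K * mu Q < D * K * |f|_1 / lambda, against the choice of lambda. *)
Lemma stopping_set_container (D : R) f (lambda : R) Q :
  (0 < D)%R -> (forall S, A S -> doubling_set mu D S) ->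
  (0 < lambda)%R -> mu.-integrable setT (EFin \o f) ->
  (D * K)%:E * \int[mu]_y `|(f y)%:E| <= lambda%:E * mu setT ->
  stopping_set f lambda Q ->
  exists S r x, [/\ measurable S, enlarge mu A Q `<=` S,
    mu S <= K%:E * mu Q, \int[mu]_(y in S) `|(f y)%:E| <= lambda%:E * mu S &
    [/\ mu S < +oo, (0 < r)%R, S `<=` ball x (D * r)%R &
      mu [set y | dist_set y S < r%:E] <= (D + 1)%:E * mu S]].
Proof.
move=> D0 doubA l0 intf large [AQ lQ [S [AS QS muS avgS]]].
have mQ := A_meas AQ; have mS := A_meas AS.
move: lQ; rewrite average_gt// ?A_pos// => lQ.
have Qoo : mu Q < +oo.
  rewrite ltey; apply/eqP => Qoo; move: (lt_trans lQ (integral_abs_lty intf mQ)).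
  by rewrite Qoo gt0_muley// lte_fin.
have Qfin : mu Q \is a fin_num by rewrite ge0_fin_numE.
have Soo : mu S < +oo.
  by apply: (le_lt_trans muS); rewrite -(fineK Qfin) -EFinM ltry.
have dS : diam S < +oo.
  rewrite ltey; apply/eqP => dSoo; have := doubA S AS.
  rewrite /doubling_set dSoo gt0_muley ?lte_fin ?invr_gt0//.
  rewrite (_ : [set _ | _] = setT); last by apply/seteqP; split=> // y _ /=; exact: leey.
  apply/negP; rewrite -ltNge.
  rewrite -(@lte_pmul2l _ lambda%:E)//; apply: lt_le_trans large.
  apply: (@le_lt_trans _ _ ((D * K)%:E * (lambda%:E * mu Q))).
    rewrite muleCA EFinM -muleA lee_pmul2l// muleCA lee_pmul2l//.
  by rewrite lte_pmul2l ?lte_fin ?mulr_gt0// (lt_le_trans lQ)// le_integral_abs_setT.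
have [r [x [r0 Sb nbS]]] := doubling_neighbourhood D0 mS (member_nonempty AS)
  (introT andP (conj (A_pos AS) Soo)) dS (doubA S AS).
exists S, r, x; split=> //.
by move: avgS; rewrite average_le// A_pos.
Qed.

(** Almost every y is in arbitrarily small sets of A, whose averages approximate
|f y|; were |f y| > lambda, one of these sets would have high average. *)
Lemma ae_low_off_high_averages f (lambda : R) (U : set M) :
  dense_family mu A -> mu.-integrable setT (EFin \o f) ->
  (forall Q, A Q -> lambda%:E < average mu f Q -> Q `<=` U) ->
  {ae mu, forall y, ~ U y -> (`|f y| <= lambda)%R}.
Proof.
rewrite /dense_family => denseA intf highU.
have := averages_differentiate intf.
apply: filterS2 denseA => y denseA diff nUy; rewrite leNgt; apply/negP => lfy.
have e0 : (0 < (`|f y| - lambda) / 2)%R by rewrite divr_gt0// subr_gt0.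
have [delta d0 close] := diff _ e0.
have [Q [AQ Qy dQ]] := denseA _ d0.
apply: nUy; apply: (highU Q AQ _ y Qy).
have /andP[+ _] := close Q AQ Qy dQ; apply: lt_le_trans.
by rewrite lte_fin; lra.
Qed.

Lemma dense_doubling_calderon_zygmund (D : R) : (0 < D)%R ->
  dense_family mu A -> (forall Q, A Q -> doubling_set mu D Q) ->
  calderon_zygmund_property mu.
Proof.
move=> D0 denseA doubA.
(* 2 serves the L^1 bound, D the balls, K the bound on g, (D + 1) * K the
   neighbourhoods; D * K excludes unbounded containers *)
pose c := (2 + D + (D + 1) * K)%R.
have [c0 c_DK c_K c_D c_2] : [/\ (0 < c)%R, (D * K <= c)%R, (K <= c)%R, (D <= c)%R & (2 <= c)%R].
  have := K_gt0; have : (0 < D * K)%R by rewrite mulr_gt0.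
  rewrite /c mulrDl mul1r; move: K (D * K)%R => k dk.
  by split; lra.
have c_1 : (1 <= c)%R by rewrite (le_trans _ c_2)// ler1n.
exists c => // f intf lambda; rewrite Lnorm1.
have Nfin : \int[mu]_y `|(f y)%:E| \is a fin_num.
  by rewrite ge0_fin_numE ?integral_ge0// integral_abs_lty.
set N := \int[mu]_y `|(EFin \o f) y|.
pose n := fine N.
have nE : N = n%:E by rewrite fineK.
have n0 : (0 <= n)%R by rewrite fine_ge0// integral_ge0.
rewrite nE => level.
have [|l0 large] := @level_bounds R c n lambda (mu setT) c0 n0 (measure_ge0 _ _) _ level.
  move=> T0; apply: EFin_inj; rewrite -nE.
  by apply: null_set_integral => //; exact: measurable_int (integrable_abse intf).
have large' (k : R) : (0 <= k <= c)%R -> (k * n)%:E <= lambda%:E * mu setT.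
  by move=> /andP[_ kc]; apply: le_trans large; rewrite lee_fin ler_wpM2r.
have B_high : stopping_set f lambda `<=` [set Q | A Q /\ lambda%:E < average mu f Q].
  by move=> Q [].
have [F [BF tF sumF hitF]] := high_average_selection l0 intf B_high.
have mF k : measurable (F k).
  by have [[/A_meas]|->] := BF k.
(* p k is the triple of the container S k, the radius r k and the centre x k *)
have dataP k : exists p : set M * R * M, [/\ measurable p.1.1, F k `<=` p.1.1,
    mu p.1.1 <= K%:E * mu (F k),
    \int[mu]_(y in p.1.1) `|(f y)%:E| <= lambda%:E * mu p.1.1 &
    [/\ (stopping_set f lambda (F k) /\ enlarge mu A (F k) `<=` p.1.1) \/
          p.1.1 = set0,
        mu p.1.1 < +oo, (0 < p.1.2)%R, p.1.1 `<=` ball p.2 (D * p.1.2)%R &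
        mu [set y | dist_set y p.1.1 < p.1.2%:E] <= (D + 1)%:E * mu p.1.1]].
  have [stopF|F0] := BF k.
    have [|S [r [x [mS FS muS avgS [Soo r0 Sb nbS]]]]] :=
      stopping_set_container D0 doubA l0 intf _ stopF.
      by rewrite -/N nE -EFinM; apply: large'; rewrite ltW ?mulr_gt0.
    exists (S, r, x); split=> //=.
      by apply: subset_trans FS; apply: member_sub_enlarge => //; case: stopF.
    by split=> //; left.
  exists (set0, 1%R, point); split=> //=.
  - by rewrite F0.
  - by rewrite F0 !measure0 mule0.
  - by rewrite integral_set0 measure0 mule0.
  - split=> //; [by right|by rewrite measure0|].
    rewrite (_ : [set _ | _] = set0) ?measure0 ?mule0//.
    by rewrite -subset0 => y /dist_set_ltP[].
have [p pP] := choice dataP.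
pose S k := (p k).1.1; pose r k := (p k).1.2; pose x k := (p k).2.
have mS k : measurable (S k) by have [] := pP k.
have FS k : F k `<=` S k by have [] := pP k.
have muS k : mu (S k) <= K%:E * mu (F k) by have [] := pP k.
have avgS k : \int[mu]_(y in S k) `|(f y)%:E| <= lambda%:E * mu (S k).
  by have [] := pP k.
have Soo k : mu (S k) < +oo by have [_ _ _ _ []] := pP k.
have r0 k : (0 < r k)%R by have [_ _ _ _ []] := pP k.
have [E [mE tE FE ES UE]] := disjoint_refinement mF mS FS tF.
have muES k : mu (E k) <= mu (S k) by apply: le_measure; rewrite ?inE.
have meanP k := mean_correction intf (mE k) (le_lt_trans (muES k) (Soo k)).
have [a aP] := choice meanP.
(* F k is inside E k and carries at least the fraction 1 / K of the measure of S k,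
   so passing from S k to E k costs at most a factor K in the mean of |f| *)
have a_bound k y : E k y -> (`|a k| <= K * lambda)%R.
  move=> Eky; have [_ _ aI _] := aP k.
  have F0 : 0 < mu (F k).
    have [_ _ _ _ [[[[AF _ _] _]|S0] _ _ _ _]] := pP k; first exact: A_pos.
    by have := ES k _ Eky; rewrite /S S0.
  have FleE : mu (F k) <= mu (E k) by apply: le_measure; rewrite ?inE.
  have E0 : 0 < mu (E k) by exact: lt_le_trans FleE.
  have Efin : mu (E k) \is a fin_num.
    by rewrite ge0_fin_numE// (le_lt_trans (muES k)).
  rewrite -lee_fin -(@lee_pmul2r _ (mu (E k)))//.
  apply: (le_trans aI).
  apply: (@le_trans _ _ (\int[mu]_(y in S k) `|(f y)%:E|)).
    by apply: ge0_subset_integral => //; exact: measurable_abs intf.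
  apply: (le_trans (avgS k)); rewrite EFinM (muleC K%:E) -muleA lee_pmul2l//.
  by apply: (le_trans (muS k)); rewrite lee_pmul2l.
(* off the containers g is f, replaced by 0 on the null set where |f| > lambda *)
pose low := [set y | (`|f y| <= lambda)%R].
have mf := integrable_measurable intf.
have mlow : measurable low.
  have := @measurable_fun_le _ M R setT (fun y => `|f y|%R) (cst lambda) measurableT.
  rewrite setTI; apply => //; exact: measurableT_comp.
have mh : measurable_fun setT (f \_ low).
  by apply/(measurable_restrict _ mlow measurableT); exact: measurable_funTS.
have [g mg [gE gout]] := measurable_piecewise_cst a mE tE mh.
pose f_ k := (fun y => f y - a k)%R \_ (E k).
have cover Q : A Q -> lambda%:E < average mu f Q -> Q `<=` \bigcup_n E n.
  move=> AQ lQ.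
  have lT : N <= lambda%:E * mu setT.
    by rewrite nE -[n]mul1r; apply: large'; rewrite ler01.
  have [Q' stopQ' QQ'] := exists_stopping_set l0 intf lT AQ lQ.
  have [k [stopF [z [Fz Qz]] muQ]] := hitF _ stopQ'.
  rewrite UE => y /QQ' Qy; exists k => //.
  have [_ _ _ _ [[[_ sub]|S0] _ _ _ _]] := pP k.
    by apply: sub; exists Q' => //; split; [by case: stopQ'|by exists z|].
  by have := FS k _ Fz; rewrite /S S0.
have lowU := ae_low_off_high_averages denseA intf cover.
exists f_, g, E, r, x; split.
- split=> //.
  + by move=> k; have [] := aP k.
  + apply: filterS lowU => y lowy; apply: cvg_near_cst.
    have [[k _ Eky]|nEy] := pselect ((\bigcup_n E n) y).
      near=> m; have km : (k < m)%N by near: m; exact: nbhs_infty_gt.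
      rewrite big_mkord (bigD1 (Ordinal km))//= big1 ?addr0.
        by rewrite /f_ patchE mem_set// (gE k y Eky).
      move=> i ik; rewrite /f_ patchE memNset// => Eiy.
      move/eqP: ik; apply; apply: val_inj => /=; apply: tE => //.
      by exists y.
    near=> m; rewrite big1 ?gout//; last first.
      by move=> i _; rewrite /f_ patchE memNset// => Eiy; apply: nEy; exists i.
    by rewrite patchE mem_set ?subrr//; exact: lowy.
- by move=> k y nEy; rewrite /f_ patchE memNset.
- by move=> k; have [] := aP k.
- move=> k y /ES Sy; have [_ _ _ _ [_ _ _ Sb _]] := pP k.
  apply: (@le_ball _ _ _ (D * r k)%R); last exact: Sb.
  by rewrite ler_wpM2r// ltW.
split.
- apply: (@le_trans _ _ (\sum_(k <oo) ((D + 1) * K)%:E * mu (F k))).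
    apply: lee_nneseries => // k _.
    have [_ _ _ _ [_ _ _ _ nbS]] := pP k.
    apply: (@le_trans _ _ ((D + 1)%:E * mu (S k))).
      apply: le_trans nbS; apply: le_measure; rewrite ?inE.
      + exact/open_measurable_set/open_dist_set_lt.
      + exact/open_measurable_set/open_dist_set_lt.
      + by move=> y /dist_set_ltP[s /ES Ss ys]; apply/dist_set_ltP; exists s.
    by rewrite EFinM -muleA lee_pmul2l ?lte_fin ?addr_gt0.
  rewrite nneseriesZl//; apply: (@le_trans _ _ (((D + 1) * K)%:E * (lambda^-1%:E * N))).
    by rewrite lee_pmul2l// lte_fin mulr_gt0// addr_gt0.
  rewrite Lnorm1 -/N inver gt_eqF// nE -!EFinM lee_fin [(n / _)%R]mulrC ler_wpM2r//.
    by rewrite mulr_ge0// invr_ge0 ltW.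
  by rewrite /c lerDr addr_ge0// ltW.
- apply: (@le_trans _ _ (\sum_(k <oo) 2%:E * \int[mu]_(y in E k) `|(f y)%:E|)).
    apply: lee_nneseries => [k _ _|k _]; first exact: Lnorm_ge0.
    by rewrite Lnorm1; have [] := aP k.
  rewrite nneseriesZl; last by move=> k _; exact: integral_ge0.
  apply: (@le_trans _ _ (2%:E * N)).
    by rewrite lee_pmul2l//; exact: sum_integral_abs_le.
  by rewrite Lnorm1 -/N nE -!EFinM lee_fin ler_wpM2r.
- move=> y; have [[k _ Eky]|nEy] := pselect ((\bigcup_n E n) y).
    by rewrite (gE k y Eky) (le_trans (a_bound k y Eky))// ler_wpM2r// ltW.
  rewrite gout// patchE; case: ifPn => [|_].
    by rewrite inE => /le_trans; apply; rewrite ler_peMl// ltW.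
  by rewrite normr0 mulr_ge0// ltW.
Unshelve. all: by end_near. Qed.

End doubling_family.

Theorem theorem1p3 (d : measure_display) (R : realType)
    (M : metricMeasurableType d R) (mu : {measure set M -> \bar R})
    (borelM : borel_space M)
    (separableM : separable M)
    (ball_fin : forall (x : M) (r : R), mu (ball x r) < +oo)
    (A : set (set M))
    (A_meas : forall Q, A Q -> measurable Q)
    (A_pos : forall Q, A Q -> 0 < mu Q)
    (A_doubling : doubling_family mu A) :
  [/\ maximal_weak_type11 mu A,
      dense_family mu A ->
        forall f : M -> R, mu.-integrable setT (EFin \o f) ->
          {ae mu, forall x,
            maximal mu (A `&` [set Q | diam Q <= r%:E]) f x @[r --> 0%R^'+] -->
              `|f x|%:E} &
      dense_family mu A ->
        (exists2 C : R, (0 < C)%R & forall Q, A Q -> doubling_set mu C Q) ->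
        calderon_zygmund_property mu].
Proof.
have [C dA] := A_doubling; split.
- exact: (doubling_maximal_weak_type11 A_meas A_pos dA).
- by move=> denseA f; exact: (dense_family_maximal_cvg borelM ball_fin A_meas A_pos dA).
- move=> denseA [D D0 doubA].
  exact: (dense_doubling_calderon_zygmund borelM ball_fin A_meas A_pos dA D0).
Qed.
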